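(* A magma with inverses satisfying the left Bol identity $(x\cdot (y\cdot x))\cdot z = x\cdot (y\cdot (x\cdot z))$ (for all $x,y,z$) is a loop. Thus, left Bol loops are defined equationally by $$1\cdot x = x\cdot 1 = x,\quad x\cdot x^{-1} = x^{-1}\cdot x = 1,\quad (x\cdot (y\cdot x))\cdot z = x\cdot (y\cdot (x\cdot z)),$$ that is, a set $M$ with a binary operation $\cdot$ and an element $1\in M$ is a left Bol loop with neutral element $1$ if and only if there is a unary operation $x\mapsto x^{-1}$ on $M$ such that these identities hold for all $x,y,z\in M$.
   Context: A magma here is a set with a single binary operation $\cdot$ possessing a two-sided neutral element $1$. A magma $M$ is with inverses if for every $x\in M$ there is $y\in M$ satisfying $x\cdot y = y\cdot x = 1$ (such $y$ is not assumed unique). A loop is a magma in which every equation $x\cdot y = z$ has a unique solution whenever two of the elements $x,y,z$ are specified; equivalently, all left translations $y\mapsto x\cdot y$ and all right translations $y\mapsto y\cdot x$ are bijections. A left Bol loop is a loop satisfying the left Bol identity $(x\cdot (y\cdot x))\cdot z = x\cdot (y\cdot (x\cdot z))$ for all $x,y,z$. *)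

(* Defs.v *)
From HB Require Import structures.
From mathcomp Require Import all_boot.

Set Implicit Arguments.
Unset Strict Implicit.
Unset Printing Implicit Defensive.

Local Open Scope group_scope.

(* [baseUMagmaType] only packs an arbitrary [Type] with a binary operation and
   a distinguished element [1], without any law. It is preferred to
   [umagmaType], which includes the unit laws but also requires a choiceType. *)

Definition is_unital (M : baseUMagmaType) : Prop :=
  left_id (1 : M) mul /\ right_id (1 : M) mul.

(* [y] may depend on [x] in a non-unique way. *)
Definition with_inverses (M : baseUMagmaType) : Prop :=
  forall x : M, exists y : M, x * y = 1 /\ y * x = 1.

Definition left_bol (M : baseUMagmaType) : Prop :=
  forall x y z : M, (x * (y * x)) * z = x * (y * (x * z)).

(* The remaining case, x and y specified and z unknown, is trivial. *)
Definition uniquely_divisible (M : baseUMagmaType) : Prop :=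
  (forall x z : M, exists! y : M, x * y = z) /\
  (forall y z : M, exists! x : M, x * y = z).

Definition is_loop (M : baseUMagmaType) : Prop :=
  is_unital M /\ uniquely_divisible M.

Definition is_left_bol_loop (M : baseUMagmaType) : Prop :=
  is_loop M /\ left_bol M.

(* Main.v *)
Require Import Defs.
From mathcomp Require Import all_boot.
From Stdlib Require Import IndefiniteDescription.

Local Open Scope group_scope.

(** Write [L_x] for the left translation [z |-> x * z].  The left Bol identity
    says [L_x L_y L_x = L_(x (y x))]; for [y = 1] it gives
    [L_x L_x = L_(x x)].  If [y] is a two-sided inverse of [x], then
    [(y y) x = y (y x) = y], so that
      [L_x L_y L_y L_x = L_x L_(y y) L_x = L_(x ((y y) x)) = L_(x y) = 1].
    Hence [L_x] is bijective, and [L_x L_y L_x = L_(x (y x)) = L_x] then shows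
    that [L_y] is its inverse ([bol_mulKV]).

    The right translations follow from the left ones: if [u x = z], then
    [L_x L_u L_x = L_(x z)], so [L_u = L_y L_(x z) L_y], and evaluation at [1]
    forces [u = y ((x z) y)], which is indeed a solution.

    For the equational description, it remains to see that the right inverse
    of an element of a left Bol loop is also a left inverse
    ([bol_loop_with_inverses]), and to choose an inverse for each element. *)

Section LeftBolMagma.

Variable M : baseUMagmaType.
Hypotheses (unitM : is_unital M) (bolM : left_bol M).

Lemma bol_sqr (x z : M) : (x * x) * z = x * (x * z).
Proof. by case: unitM => mul1 _; move: (bolM x 1 z); rewrite !mul1. Qed.

(** The middle factor is [L_y L_y = L_(y y)], so by the Bol identity the
    composite is left translation by [x ((y y) x) = x (y (y x)) = x y = 1]. *)
Lemma bol_translation_cycle (x y z : M) :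
  x * y = 1 -> y * x = 1 -> x * (y * (y * (x * z))) = z.
Proof.
case: unitM => mul1 mulr1 xy1 yx1.
by rewrite -bol_sqr -bolM bol_sqr yx1 mulr1 xy1 mul1.
Qed.

Lemma bol_mulKV (x y z : M) : x * y = 1 -> y * x = 1 -> y * (x * z) = z.
Proof.
case: unitM => _ mulr1 xy1 yx1.
(* [L_x] is injective by [bol_translation_cycle], and [L_x L_y L_x = L_x]. *)
have xyxz : x * (y * (x * z)) = x * z by rewrite -bolM yx1 mulr1.
by rewrite -[LHS](bol_translation_cycle x y) // xyxz bol_translation_cycle.
Qed.

Lemma bol_with_inverses_loop : with_inverses M -> is_loop M.
Proof.
case: (unitM) => _ mulr1 invM; split=> //; split=> x z;
  have [y [xy1 yx1]] := invM x.
  exists (y * z); split=> [|u <-]; first exact: bol_mulKV.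
  exact: bol_mulKV.
exists (y * ((x * z) * y)); split=> [|u <-].
  by rewrite bolM yx1 mulr1 bol_mulKV.
by rewrite bolM xy1 mulr1 bol_mulKV.
Qed.

(** If [x y = 1], then [(x (y x)) y = x (y (x y)) = x y], and cancelling [y]
    on the right and then [x] on the left gives [y x = 1]. *)
Lemma bol_loop_with_inverses : uniquely_divisible M -> with_inverses M.
Proof.
case: unitM => _ mulr1 [ldivM rdivM] x.
have [y [xy1 _]] := ldivM x 1; exists y; split=> //.
have xyx : x * (y * x) = x.
  have [w [_ w_uniq]] := rdivM y 1.
  by apply: etrans (w_uniq _ xy1); apply/esym/w_uniq; rewrite bolM xy1 mulr1.
have [w [_ w_uniq]] := ldivM x x.
by apply: etrans (w_uniq _ (mulr1 x)); apply/esym/w_uniq.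
Qed.

End LeftBolMagma.

Theorem theorem4p1 (M : baseUMagmaType) :
  (is_unital M -> with_inverses M -> left_bol M -> is_loop M) /\
  (is_left_bol_loop M <->
   exists inv : M -> M,
     (forall x : M, 1 * x = x /\ x * 1 = x) /\
     (forall x : M, x * inv x = 1 /\ inv x * x = 1) /\
     (forall x y z : M, (x * (y * x)) * z = x * (y * (x * z)))).
Proof.
split=> [unitM invM bolM|]; first exact: bol_with_inverses_loop.
split=> [[[unitM divM] bolM]|[inv [mul1 [mulV bolM]]]].
  have /functional_choice[inv mulV] := bol_loop_with_inverses M unitM bolM divM.
  by exists inv; case: (unitM) => mul1 mulr1; split.
have unitM : is_unital M by split=> x; case: (mul1 x).
split=> //; apply: bol_with_inverses_loop => // x.
by exists (inv x); apply: mulV.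
Qed.
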